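(* Let $f:R_{1}\rightarrow R_{2}$ be a homomorphism of commutative rings with identity, $J$ an ideal of $R_{2}$, $M_{1}$ an $R_{1}$-module, $M_{2}$ an $R_{2}$-module (regarded as an $R_1$-module via $f$) and $\varphi:M_{1}\rightarrow M_{2}$ an $R_{1}$-module homomorphism. Consider the $(R_{1}\Join^{f}J)$-module $M_{1}\Join^{\varphi}JM_{2}$ and let $N_{2}$ be a submodule of $M_{2}$. (1) If $N_{2}$ is an $n$-submodule of $M_{2}$, $JM_{2}=\{0_{M_{2}}\}$ and $\varphi$ is an isomorphism, then $\overline{N_{2}}^{\varphi}$ is an $n$-submodule of $M_{1}\Join^{\varphi}JM_{2}$. (2) If $f$ and $\varphi$ are epimorphisms and $\overline{N_{2}}^{\varphi}$ is an $n$-submodule of $M_{1}\Join^{\varphi}JM_{2}$, then $N_{2}$ is an $n$-submodule of $M_{2}$. (3) If $f$ is an isomorphism, $\varphi$ is an epimorphism and $\overline{N_{2}}^{\varphi}$ is a semi $n$-submodule of $M_{1}\Join^{\varphi}JM_{2}$, then $N_{2}$ is a semi $n$-submodule of $M_{2}$.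
   Context: Modules are unital; ''epimorphism'' means surjective homomorphism. $R_{1}\Join^{f}J=\{(r,f(r)+j): r\in R_1, j\in J\}$ is a subring of $R_1\times R_2$ (the amalgamation of $R_1$ and $R_2$ along $J$ with respect to $f$). $M_{1}\Join^{\varphi}JM_{2}=\{(m_1,\varphi(m_1)+m_2): m_1\in M_1, m_2\in JM_2\}$ is an $(R_1\Join^f J)$-module with scalar product $(r,f(r)+j)(m_1,\varphi(m_1)+m_2)=(rm_1,\varphi(rm_1)+f(r)m_2+j\varphi(m_1)+jm_2)$. For a submodule $N_2$ of $M_2$, $\overline{N_{2}}^{\varphi}=\{(m_1,\varphi(m_1)+m_2)\in M_1\Join^{\varphi}JM_2: \varphi(m_1)+m_2\in N_2\}$, a submodule of $M_{1}\Join^{\varphi}JM_{2}$. Let $A$ be a commutative ring with nilradical $\sqrt{0_A}$, $X$ an $A$-module and $Y$ a proper submodule of $X$. $Y$ is an $n$-submodule if whenever $a\in A$, $x\in X$ with $ax\in Y$ and $a\notin\sqrt{Ann_A(X)}$, then $x\in Y$, where $Ann_A(X)=\{a\in A:aX=0\}$. $Y$ is a semi $n$-submodule if whenever $a\in A$, $x\in X$ with $a^{2}x\in Y$, $a\notin\sqrt{0_A}$ and $Ann_A(x)=\{b\in A: bx=0\}=0$, then $ax\in Y$. *)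

(* Defs.v *)
From HB Require Import structures.
From mathcomp Require Import all_boot all_algebra.
From mathcomp Require Import boolp.

Set Implicit Arguments.
Unset Strict Implicit.
Unset Printing Implicit Defensive.

Import GRing.Theory.
Local Open Scope ring_scope.

(* Rings are comPzRingType: commutative with identity, the zero ring allowed. *)
(* Submodules are bundled boolean predicates, submodClosed X; by the classical *)
(* `[< _ >] of boolp every subset of X is such a predicate.                    *)

Section NSubmodules.
Variables (A : comPzRingType) (X : lmodType A).

Definition Ann : A -> Prop := fun a => forall x : X, a *: x = 0.

Definition AnnElt (x : X) : A -> Prop := fun b => b *: x = 0.

Definition radical (I : A -> Prop) : A -> Prop :=
  fun a => exists n : nat, (0 < n)%N /\ I (a ^+ n).

Definition nilradical : A -> Prop := radical (fun a => a = 0).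

Definition proper_submodule (Y : submodClosed X) : Prop :=
  exists x : X, x \notin Y.

Definition n_submodule (Y : submodClosed X) : Prop :=
  proper_submodule Y /\
  forall (a : A) (x : X), a *: x \in Y -> ~ radical Ann a -> x \in Y.

Definition semi_n_submodule (Y : submodClosed X) : Prop :=
  proper_submodule Y /\
  forall (a : A) (x : X),
    a ^+ 2 *: x \in Y -> ~ nilradical a ->
    (forall b : A, AnnElt x b <-> b = 0) -> a *: x \in Y.

End NSubmodules.

Arguments Ann {A} X.

(* An ideal of R is a submodule of the regular module R^o; unlike the library  *)
(* idealr_closed, this does not require the ideal to be proper.                *)
Notation idealOf R := (submodClosed (R : comPzRingType)^o).

Section IdealClosure.
Variables (R : comPzRingType) (J : idealOf R).

Lemma idealMl (a j : R) : j \in J -> a * j \in J.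
Proof. exact: (@rpredZ R R^o J a j). Qed.

Lemma idealD (i j : R) : i \in J -> j \in J -> i + j \in J.
Proof. move=> Ji Jj; exact: (@rpredD _ J i j Ji Jj). Qed.

Lemma idealB (i j : R) : i \in J -> j \in J -> i - j \in J.
Proof. by move=> Ji Jj; rewrite -mulN1r; apply: idealD => //; exact: idealMl. Qed.

End IdealClosure.

Section IdealTimesModule.
Variables (R : comPzRingType) (J : idealOf R) (M : lmodType R).

Definition ideal_mul : {pred M} := fun y =>
  `[< exists (n : nat) (j : 'I_n -> R) (m : 'I_n -> M),
      (forall i, j i \in J) /\ y = \sum_(i < n) j i *: m i >].

Lemma ideal_mulP y : reflect
  (exists (n : nat) (j : 'I_n -> R) (m : 'I_n -> M),
      (forall i, j i \in J) /\ y = \sum_(i < n) j i *: m i)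
  (y \in ideal_mul).
Proof. exact: asboolP. Qed.

Fact ideal_mul_submod_closed : submod_closed ideal_mul.
Proof.
split.
  by apply/ideal_mulP; exists 0%N, (fun=> 0), (fun=> 0); split=> [[]//|]; rewrite big_ord0.
move=> a u v /ideal_mulP[n [j [m [Jj ->]]]] /ideal_mulP[p [k [l [Jk ->]]]].
apply/ideal_mulP; exists (n + p)%N.
exists (fun i => match split i with inl i => a * j i | inr i => k i end).
exists (fun i => match split i with inl i => m i | inr i => l i end).
split=> [i|].
  case: (split i) => // i'; exact: idealMl.
rewrite big_split_ord /= scaler_sumr; congr (_ + _); apply: eq_bigr => i _.
  by rewrite (unsplitK (inl i)) scalerA.
by rewrite (unsplitK (inr i)).
Qed.

HB.instance Definition _ :=
  GRing.isSubmodClosed.Build R M ideal_mul ideal_mul_submod_closed.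

Lemma mem_ideal_mul j (m : M) : j \in J -> j *: m \in ideal_mul.
Proof.
move=> Jj; apply/ideal_mulP; exists 1%N, (fun=> j), (fun=> m).
by split=> //; rewrite big_ord1.
Qed.

End IdealTimesModule.

Arguments ideal_mul {R} J M.

Section Amalgamation.
Variables (R1 R2 : comPzRingType) (f : {rmorphism R1 -> R2}) (J : idealOf R2).

Definition amalg_pred : {pred (R1 * R2)%type} := fun x =>
  `[< exists (r : R1) (j : R2), j \in J /\ x = (r, f r + j) >].

Lemma amalg_predE x : (x \in amalg_pred) = (x.2 - f x.1 \in J).
Proof.
apply/idP/idP => [/asboolP[r [j [Jj ->]]]/=|Jx].
  by rewrite addrC addKr.
by apply/asboolP; exists x.1, (x.2 - f x.1); split; rewrite // subrKC; case: (x).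
Qed.

Fact amalg_subring_closed : subring_closed amalg_pred.
Proof.
split=> [|x y|x y]; rewrite !amalg_predE /=.
- by rewrite rmorph1 subrr; exact: (rpred0 J).
- move=> Jx Jy; have -> : x.2 - y.2 - f (x.1 - y.1)
          = (x.2 - f x.1) - (y.2 - f y.1).
    by rewrite rmorphB !opprB [f y.1 - f x.1]addrC addrACA [- y.2 + _]addrC.
  exact: idealB.
- move=> Jx Jy; rewrite rmorphM.
  have -> : x.2 * y.2 - f x.1 * f y.1
          = y.2 * (x.2 - f x.1) + f x.1 * (y.2 - f y.1).
    by rewrite !mulrBr [y.2 * f x.1]mulrC addrA subrK mulrC.
  by apply: idealD; exact: idealMl.
Qed.

HB.instance Definition _ :=
  GRing.isSubringClosed.Build (R1 * R2)%type amalg_pred amalg_subring_closed.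

(* The amalgamation of R1 and R2 along J with respect to f, with the ring      *)
(* structure inherited from the product R1 * R2.                               *)
Record amalg : Type := Amalg {
  amalg_val :> (R1 * R2)%type;
  _ : amalg_val \in amalg_pred }.

HB.instance Definition _ := [isSub for amalg_val].
HB.instance Definition _ := [Choice of amalg by <:].
HB.instance Definition _ := GRing.SubChoice_isSubComPzRing.Build
  (R1 * R2)%type amalg_pred amalg amalg_subring_closed.

End Amalgamation.

Section AmalgamatedModule.
Variables (R1 R2 : comPzRingType) (f : {rmorphism R1 -> R2}) (J : idealOf R2).
Variables (M1 : lmodType R1) (M2 : lmodType R2).
(* M2 is seen as an R1-module via f: phi (r *: m) = f r *: phi m.              *)
Variable phi : {linear M1 -> M2 | f \; *:%R}.

Definition amalg_mod_pred : {pred (M1 * M2)%type} := fun x =>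
  `[< exists (m1 : M1) (m2 : M2), m2 \in ideal_mul J M2 /\ x = (m1, phi m1 + m2) >].

Lemma amalg_mod_predE x :
  (x \in amalg_mod_pred) = (x.2 - phi x.1 \in ideal_mul J M2).
Proof.
apply/idP/idP => [/asboolP[m1 [m2 [Jm ->]]]/=|Jx].
  by rewrite addrC addKr.
by apply/asboolP; exists x.1, (x.2 - phi x.1); split; rewrite // subrKC; case: (x).
Qed.

Fact amalg_mod_zmod_closed : zmod_closed amalg_mod_pred.
Proof.
split=> [|x y]; rewrite !amalg_mod_predE /=.
  by rewrite raddf0 subrr rpred0.
move=> Jx Jy; rewrite raddfB.
have -> : x.2 - y.2 - (phi x.1 - phi y.1) = (x.2 - phi x.1) - (y.2 - phi y.1).
  by rewrite !opprB [phi y.1 - phi x.1]addrC addrACA [- y.2 + _]addrC.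
exact: rpredB.
Qed.

HB.instance Definition _ :=
  GRing.isZmodClosed.Build (M1 * M2)%type amalg_mod_pred amalg_mod_zmod_closed.

Record amalg_mod : Type := AmalgMod {
  amalg_mod_val :> (M1 * M2)%type;
  _ : amalg_mod_val \in amalg_mod_pred }.

HB.instance Definition _ := [isSub for amalg_mod_val].
HB.instance Definition _ := [Choice of amalg_mod by <:].
HB.instance Definition _ := [SubChoice_isSubZmodule of amalg_mod by <:].

Fact amalg_scale_subproof (a : amalg f J) (x : amalg_mod) :
  ((val a).1 *: (val x).1, (val a).2 *: (val x).2) \in amalg_mod_pred.
Proof.
case: a x => [[r s] /= ra] [[m n] /= xm].
move: ra xm; rewrite amalg_predE !amalg_mod_predE /= => Jrs Jmn.
rewrite linearZ /=.
have -> : s *: n - f r *: phi m = s *: (n - phi m) + (s - f r) *: phi m.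
  by rewrite scalerBr scalerBl addrA subrK.
by apply: rpredD; [exact: rpredZ | exact: mem_ideal_mul].
Qed.

(* Scalars act componentwise; amalg_scaleE gives the action in the             *)
(* parametrization (r, f r + j), (m1, phi m1 + m2).                            *)
Definition amalg_scale (a : amalg f J) (x : amalg_mod) : amalg_mod :=
  AmalgMod (amalg_scale_subproof a x).

Fact amalg_scaleA a b x :
  amalg_scale a (amalg_scale b x) = amalg_scale (a * b) x.
Proof. by apply/val_inj; rewrite /= !scalerA. Qed.

Fact amalg_scale1 : left_id 1 amalg_scale.
Proof. by move=> x; apply/val_inj; rewrite /= !scale1r; case: (val x). Qed.

Fact amalg_scaleDr : right_distributive amalg_scale +%R.
Proof. by move=> a x y; apply/val_inj; rewrite /= !scalerDr. Qed.

Fact amalg_scaleDl x : {morph amalg_scale^~ x : a b / a + b}.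
Proof. by move=> a b; apply/val_inj; rewrite /= !scalerDl. Qed.

HB.instance Definition _ := GRing.Zmodule_isLmodule.Build (amalg f J) amalg_mod
  amalg_scaleA amalg_scale1 amalg_scaleDr amalg_scaleDl.

Lemma amalg_scaleE (a : amalg f J) (x : amalg_mod) r j m1 m2 :
  val a = (r, f r + j) -> val x = (m1, phi m1 + m2) ->
  val (a *: x)
  = (r *: m1, phi (r *: m1) + f r *: m2 + j *: phi m1 + j *: m2).
Proof.
move=> va vx; rewrite /= va vx /= linearZ /=; congr (_, _).
by rewrite scalerDl !scalerDr !addrA.
Qed.

Section LiftSubmodule.
Variable N2 : submodClosed M2.

Definition lift_submod : {pred amalg_mod} := fun x => (val x).2 \in N2.

Fact lift_submod_closed : submod_closed lift_submod.
Proof.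
split=> [|a x y Nx Ny]; first exact: (rpred0 N2).
by apply: (@rpredD _ N2 (_ *: _)) => //; exact: rpredZ.
Qed.

HB.instance Definition _ := GRing.isSubmodClosed.Build
  (amalg f J) amalg_mod lift_submod lift_submod_closed.

End LiftSubmodule.
End AmalgamatedModule.

Arguments amalg_mod {R1 R2 f} J {M1 M2} phi.
Arguments lift_submod {R1 R2 f} J {M1 M2} phi N2.

(* Main.v *)
Require Import Defs.
From mathcomp Require Import all_boot all_algebra.
Import GRing.Theory.
Local Open Scope ring_scope.

(* An element (m, y) of the amalgamated module lies in the lift of N2 iff y    *)
(* lies in N2, and scalars act on y through their second coordinate, so each   *)
(* part transports the defining implication along (r, s) |-> s and             *)
(* (m, y) |-> y, or back along the sections r |-> (r, f r) and                 *)
(* m |-> (m, phi m).                                                           *)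

(** The work lies in the side conditions on scalars and annihilators. If [J M2 = 0] and [phi] is
    bijective, the second coordinate determines an element, so a power of [a] whose second
    coordinate kills [M2] kills the amalgamated module. Conversely, if [phi] is onto, a power of
    [(r, f r)] that kills the graph of [phi] gives a power of [f r] that kills [M2]. For semi
    n-submodules, injectivity of [f] also carries a zero annihilator from [phi m] to
    [(m, phi m)]. *)

Section Graph.
Variables (R1 R2 : comPzRingType) (f : {rmorphism R1 -> R2}) (J : idealOf R2).
Variables (M1 : lmodType R1) (M2 : lmodType R2).
Variable phi : {linear M1 -> M2 | f \; *:%R}.

Lemma val_amalgX (a : amalg f J) n :
  val (a ^+ n) = ((val a).1 ^+ n, (val a).2 ^+ n).
Proof. by elim: n => [|n IHn]; rewrite ?expr0 // !exprS /= IHn. Qed.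

Lemma val_amalg_modZ (a : amalg f J) (x : amalg_mod J phi) :
  val (a *: x) = ((val a).1 *: (val x).1, (val a).2 *: (val x).2).
Proof. by []. Qed.

Lemma mem_lift_submod (N2 : submodClosed M2) (x : amalg_mod J phi) :
  (x \in lift_submod J phi N2) = ((val x).2 \in N2).
Proof. by []. Qed.

Lemma amalg_graph_subproof r : (r, f r) \in amalg_pred f J.
Proof. by rewrite amalg_predE /= subrr; exact: (rpred0 J). Qed.

Definition amalg_graph r : amalg f J := Amalg (amalg_graph_subproof r).

Lemma amalg_mod_graph_subproof m : (m, phi m) \in amalg_mod_pred J phi.
Proof. by rewrite amalg_mod_predE /= subrr rpred0. Qed.

Definition amalg_mod_graph m : amalg_mod J phi :=
  AmalgMod (amalg_mod_graph_subproof m).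

Lemma lift_submod_proper (N2 : submodClosed M2) :
  proper_submodule (lift_submod J phi N2) -> proper_submodule N2.
Proof. by move=> [x Nx]; exists (val x).2. Qed.

Lemma lift_n_submodule (N2 : submodClosed M2) :
    (forall y : M2, y \in ideal_mul J M2 <-> y = 0) -> bijective phi ->
  n_submodule N2 -> n_submodule (lift_submod J phi N2).
Proof.
move=> JM0 [psi phiK psiK] [[y Ny] N2n].
(* As [J M2 = 0], the amalgamated module is just the graph of [phi]. *)
have val2 (x : amalg_mod J phi) : (val x).2 = phi (val x).1.
  by apply/subr0_eq/JM0; rewrite -amalg_mod_predE; exact: (valP x).
split; first by exists (amalg_mod_graph (psi y)); rewrite mem_lift_submod /= psiK.
move=> a x; rewrite !mem_lift_submod => Nax nilPa.
apply: N2n Nax _ => -[n [n_gt0 an0]]; apply: nilPa; exists n; split=> // z.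
have az0 : (val (a ^+ n *: z)).2 = 0 by rewrite val_amalg_modZ val_amalgX an0.
(* The first coordinate vanishes too, since its image under the injective [phi] is the second. *)
apply/val_inj; rewrite [LHS]surjective_pairing az0; congr (_, _).
by apply: (can_inj phiK); rewrite -val2 az0 raddf0.
Qed.

Lemma n_submodule_of_lift (N2 : submodClosed M2) :
    (forall r2 : R2, exists r1 : R1, f r1 = r2) ->
    (forall m2 : M2, exists m1 : M1, phi m1 = m2) ->
  n_submodule (lift_submod J phi N2) -> n_submodule N2.
Proof.
move=> f_surj phi_surj [properL Ln]; split; first exact: lift_submod_proper.
move=> a x; have [r <-] := f_surj a; have [m <-] := phi_surj x => Nax nilPa.
apply: (Ln (amalg_graph r) (amalg_mod_graph m)) => // -[n [n_gt0 rn0]].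
(* Every [y] is the second coordinate of a graph element, which [(r, f r) ^+ n] kills. *)
apply: nilPa; exists n; split=> // y; have [k <-] := phi_surj y.
by have /(congr1 (snd \o val)) := rn0 (amalg_mod_graph k); rewrite /= val_amalgX.
Qed.

Lemma semi_n_submodule_of_lift (N2 : submodClosed M2) : bijective f ->
    (forall m2 : M2, exists m1 : M1, phi m1 = m2) ->
  semi_n_submodule (lift_submod J phi N2) -> semi_n_submodule N2.
Proof.
move=> [g fK gK] phi_surj [properL Ln]; split; first exact: lift_submod_proper.
move=> a x; rewrite -(gK a); move: (g a) => r.
have [m <-] := phi_surj x => Nax nilPa annx.
apply: (Ln (amalg_graph r) (amalg_mod_graph m)).
- by rewrite mem_lift_submod val_amalg_modZ val_amalgX.
- move=> [n [n_gt0 rn0]]; apply: nilPa; exists n; split=> //.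
  by have /(congr1 (snd \o val)) := rn0; rewrite /= val_amalgX.
move=> b; split=> [bm0|->]; last by rewrite /AnnElt scale0r.
have [b1m0 b2m0] : (val b).1 *: m = 0 /\ (val b).2 *: phi m = 0.
  by have [] := congr1 val bm0.
(* Applying [phi] to the first coordinate turns it into a relation on [phi m], where the annihilator
   is known to be zero. *)
have b1_0 : f (val b).1 = 0.
  by apply/annx; have := congr1 phi b1m0; rewrite linearZ raddf0.
apply/val_inj; rewrite [LHS]surjective_pairing; congr (_, _).
  by apply: (can_inj fK); rewrite b1_0 rmorph0.
exact/annx.
Qed.

End Graph.

Theorem theorem10 (R1 R2 : comPzRingType) (f : {rmorphism R1 -> R2})
    (J : idealOf R2) (M1 : lmodType R1) (M2 : lmodType R2)
    (phi : {linear M1 -> M2 | f \; *:%R}) (N2 : submodClosed M2) :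
  [/\ n_submodule N2 ->
      (forall y : M2, y \in ideal_mul J M2 <-> y = 0) ->
      bijective phi ->
      n_submodule (lift_submod J phi N2),
      (forall r2 : R2, exists r1 : R1, f r1 = r2) ->
      (forall m2 : M2, exists m1 : M1, phi m1 = m2) ->
      n_submodule (lift_submod J phi N2) ->
      n_submodule N2
    & bijective f ->
      (forall m2 : M2, exists m1 : M1, phi m1 = m2) ->
      semi_n_submodule (lift_submod J phi N2) ->
      semi_n_submodule N2].
Proof.
split.
- by move=> N2n JM0 phi_bij; exact: lift_n_submodule.
- exact: n_submodule_of_lift.
- exact: semi_n_submodule_of_lift.
Qed.
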